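(* Let $\phi$ be an MTL$^{\downarrow}$ formula, $\mu$ and $\nu$ partial valuations, $u$ and $v$ observations, and $\tau\in\mathbb{Q}_{\geq0}$. If $u\sqsubseteq v$ and $\mu\sqsubseteq\nu$, then $[\![\phi]\!]^{\tau}_{u,\mu}\preceq[\![\phi]\!]^{\tau}_{v,\nu}$.
   Context: Setting. Fix a finite set $P$ of predicate symbols with arities $\iota(p)$, a set $V$ of variables, a finite set $R$ of registers, and a nonempty data domain $D$ with $\bot\notin D$. MTL$^{\downarrow}$ formulas: $\phi ::= \mathsf{t}\mid p(x_1,\dots,x_{\iota(p)})\mid {\downarrow^{r}}x.\,\phi\mid\neg\phi\mid\phi\vee\phi\mid \bullet_I\phi\ (\text{previous})\mid \circ_I\phi\ (\text{next})\mid\phi\,\mathsf{S}_I\,\phi\mid\phi\,\mathsf{U}_I\,\phi$, with $I$ an interval of $\mathbb{Q}_{\geq0}$ and ${\downarrow^r}x$ the freeze quantifier binding $x$ to the value of register $r$. For intervals, $A-B:=\{a-b\mid a\in A,b\in B\}\cap\mathbb{Q}_{\geq0}$. Truth values $\{\mathsf{t},\mathsf{f},\bot\}$ with strong Kleene connectives and knowledge order $\bot\prec\mathsf{t}$, $\bot\prec\mathsf{f}$; $\preceq$ is its reflexive closure. Alphabet $\Sigma$: pairs $(\sigma,\rho)$ of partial functions $\sigma:P\rightharpoonup\bigcup_p 2^{D^{\iota(p)}}$, $\rho:R\rightharpoonup D$, ordered by extension ($\sqsubseteq$); the least element is the pair of everywhere-undefined maps. Observations are finite words of letters $(I,a)$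 defined inductively: $([0,\infty),a_0)$ with $a_0$ the least letter is an observation; applying one of (T1) replace a letter $(I,a)$ with $|I|>1$ by $(I\cap[0,\tau),a)(\{\tau\},a)(I\cap(\tau,\infty),a)$ for some $\tau\in I$, $\tau>0$ (for $\tau=0$: $(\{0\},a)(I\cap(0,\infty),a)$), (T2) remove a letter $(I,a)$ with $|I|>1$ and $I$ bounded, (T3) replace a letter $(I,a)$ with $|I|=1$ by $(I,a')$ with $a\sqsubseteq a'$, yields an observation. $u\sqsubseteq v$ for observations means $v$ is obtained from $u$ by finitely many (possibly zero) such transformations. Position $i$ is a time point if its interval $I_i$ is a singleton; its element is its timestamp. For valuations, $\mu\sqsubseteq\nu$ means $\nu$ extends $\mu$. Three-valued semantics $[\![\phi]\!]_{w,i,\nu}$ for $w=(I_0,(\sigma_0,\rho_0))\dots(I_{n-1},(\sigma_{n-1},\rho_{n-1}))$, position $i$, partial valuation $\nu$: $[\![\mathsf{t}]\!]=\mathsf{t}$; $[\![p(\bar x)]\!]_{w,i,\nu}$ is $\mathsf{t}$ (resp. $\mathsf{f}$) if $\bar x\subseteq\mathrm{def}(\nu)$, $p\in\mathrm{def}(\sigma_i)$ and $\nu(\bar x)\in\sigma_i(p)$ (resp. $\notin$), else $\bot$; $[\![{\downarrow^r}x.\phi]\!]_{w,i,\nu}=[\![\phi]\!]_{w,i,\nu[x\mapsto\rho_i(r)]}$ if $r\in\mathrm{def}(\rho_i)$, otherwise evaluated with $x$ undefined; $\neg,\vee$ via Kleene. With $\mathrm{tp}_w(i)=\mathsf{t}$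 if $|I_i|=1$ else $\bot$, and $\mathrm{mc}_{w,I}(i,j)=\mathsf{t}$ if $I_i-I_j\neq\emptyset$ and $I_i-I_j\subseteq I$, $\mathsf{f}$ if $(I_i-I_j)\cap I=\emptyset$, $\bot$ otherwise: $[\![\phi\,\mathsf{S}_I\psi]\!]_{w,i,\nu}=\bigvee_{j\le i}\big(\mathrm{tp}_w(j)\wedge\mathrm{mc}_{w,I}(i,j)\wedge[\![\psi]\!]_{w,j,\nu}\wedge\bigwedge_{j<k\le i}(\mathrm{tp}_w(k)\to[\![\phi]\!]_{w,k,\nu})\big)$; $[\![\phi\,\mathsf{U}_I\psi]\!]_{w,i,\nu}=\bigvee_{j\ge i}\big(\mathrm{tp}_w(j)\wedge\mathrm{mc}_{w,I}(j,i)\wedge[\![\psi]\!]_{w,j,\nu}\wedge\bigwedge_{i\le k<j}(\mathrm{tp}_w(k)\to[\![\phi]\!]_{w,k,\nu})\big)$; $[\![\bullet_I\phi]\!]_{w,i,\nu}=c_0\vee c_{-1}\vee c_{-2}$ and $[\![\circ_I\phi]\!]_{w,i,\nu}=c_0\vee c_1\vee c_2$, where $c_0=\mathrm{mc}_{w,I}(i,i)\wedge[\![\phi]\!]_{w,i,\nu}\wedge\neg\mathrm{tp}_w(i)$ if $I\neq\{0\}$; $c_{\pm1}=\mathrm{mc}_{w,I}(\max(i,i\pm1),\min(i,i\pm1))\wedge[\![\phi]\!]_{w,i\pm1,\nu}\wedge\mathrm{tp}_w(i\pm1)\wedge\mathrm{tp}_w(i)$ if $i\pm1$ is a position; $c_{\pm2}=\mathrm{mc}_{w,I}(\max(i,i\pm2),\min(i,i\pm2))\wedge[\![\phi]\!]_{w,i\pm2,\nu}\wedge\neg\mathrm{tp}_w(i\pm1)$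 if $i\pm2$ is a position; each $c_k$ is $\mathsf{f}$ when its side condition fails. Timestamp version: $[\![\phi]\!]^{\tau}_{w,\nu}:=[\![\phi]\!]_{w,i,\nu}$ if $\tau$ is the timestamp of a time point $i$ of $w$, and $\bot$ otherwise. *)

(* Defs.v *)
From mathcomp Require Import all_boot all_order all_algebra.
From mathcomp Require Import boolp classical_sets set_interval num_normedtype.
From Stdlib Require Import Relation_Operators.

Set Implicit Arguments.
Unset Strict Implicit.
Unset Printing Implicit Defensive.

Import Order.TTheory GRing.Theory Num.Theory.
Local Open Scope classical_set_scope.
Local Open Scope ring_scope.

(** Partial functions are functions into [option]; the third truth value and
    the undefined datum [bot] are both rendered by [None]. *)

Definition pext (A : Type) (B : A -> Type) (f g : forall x, option (B x)) :=
  forall x y, f x = Some y -> g x = Some y.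

Definition tv := option bool.
Notation tt3 := (Some true : tv).
Notation ff3 := (Some false : tv).
Notation bot3 := (None : tv).

Definition klt (a b : tv) : Prop := a = bot3 /\ (b = tt3 \/ b = ff3).
Definition kle (a b : tv) : Prop := a = b \/ klt a b.

Definition knot (a : tv) : tv :=
  match a with
  | Some true => ff3
  | Some false => tt3
  | None => bot3
  end.

Definition kor (a b : tv) : tv :=
  match a, b with
  | Some true, _ | _, Some true => tt3
  | Some false, Some false => ff3
  | _, _ => bot3
  end.

Definition kand (a b : tv) : tv :=
  match a, b with
  | Some false, _ | _, Some false => ff3
  | Some true, Some true => tt3
  | _, _ => bot3
  end.

Definition kimpl (a b : tv) : tv := kor (knot a) b.

(** Intervals of the nonnegative rationals are arbitrary convex subsets: the
    empty set and intervals with irrational end points are included. *)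
Record qinterval := QInterval {
  qset :> set rat;
  qset_ge0 : forall x, qset x -> 0 <= x;
  qset_convex : is_interval qset }.

Definition qdiff (A B : set rat) : set rat :=
  [set x | 0 <= x /\ exists a b, A a /\ B b /\ x = a - b].

Section MTL.
Variables (P R : finType) (V : eqType) (D : Type) (iota : P -> nat).

Inductive mtl :=
| FTrue
| FPred (p : P) (xs : (iota p).-tuple V)
| FFreeze (r : R) (x : V) (phi : mtl)
| FNot (phi : mtl)
| FOr (phi psi : mtl)
| FPrev (I : qinterval) (phi : mtl)
| FNext (I : qinterval) (phi : mtl)
| FSince (I : qinterval) (phi psi : mtl)
| FUntil (I : qinterval) (phi psi : mtl).

Definition valuation := V -> option D.

Definition upd (nu : valuation) (x : V) (d : option D) : valuation :=
  fun y => if y == x then d else nu y.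

(** [pmap] discards the variables outside the domain of [nu], so the result has
    length [n], and [insub] succeeds, exactly when [nu] is defined on all of
    [xs]. *)
Definition eval_vars n (nu : valuation) (xs : n.-tuple V) :
    option (n.-tuple D) :=
  insub (pmap nu xs).

Definition pinterp := forall p : P, option (set ((iota p).-tuple D)).
Definition rinterp := R -> option D.
Definition letter := (pinterp * rinterp)%type.

Definition letter0 : letter := (fun=> None, fun=> None).

Definition letter_le (a b : letter) : Prop := pext a.1 b.1 /\ pext a.2 b.2.

Definition word := seq (set rat * letter).

Definition init_word : word := [:: (`[0, +oo[%classic, letter0)].

Inductive step : word -> word -> Prop :=
| T1_pos w1 w2 (I : set rat) a t :
    ~ is_subset1 I -> I t -> 0 < t ->
    step (w1 ++ (I, a) :: w2)
         (w1 ++ [:: (I `&` `[0, t[, a); ([set t], a); (I `&` `]t, +oo[, a)]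
             ++ w2)
| T1_zero w1 w2 (I : set rat) a :
    ~ is_subset1 I -> I 0 ->
    step (w1 ++ (I, a) :: w2)
         (w1 ++ [:: ([set 0], a); (I `&` `]0, +oo[, a)] ++ w2)
| T2 w1 w2 (I : set rat) a :
    ~ is_subset1 I -> has_ubound I ->
    step (w1 ++ (I, a) :: w2) (w1 ++ w2)
| T3 w1 w2 (t : rat) a a' :
    letter_le a a' ->
    step (w1 ++ ([set t], a) :: w2) (w1 ++ ([set t], a') :: w2).

Definition refines : word -> word -> Prop := clos_refl_trans word step.

Definition observation (w : word) : Prop := refines init_word w.

(** The default values of [nth] are irrelevant: positions are always
    smaller than [size w]. *)
Definition ival (w : word) (i : nat) : set rat := (nth (set0, letter0) w i).1.
Definition lett (w : word) (i : nat) : letter := (nth (set0, letter0) w i).2.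

Definition is_tp (w : word) (i : nat) : Prop := exists t, ival w i = [set t].

Definition tp (w : word) (i : nat) : tv := if `[< is_tp w i >] then tt3 else bot3.

Definition mc (w : word) (I : set rat) (i j : nat) : tv :=
  let d := qdiff (ival w i) (ival w j) in
  if `[< d !=set0 /\ d `<=` I >] then tt3
  else if `[< d `&` I = set0 >] then ff3 else bot3.

(** The disjuncts of the semantics of previous and next; [val j] stands for the
    value of the operand at position [j]. *)
Definition c_self (w : word) (I : set rat) (val : nat -> tv) (i : nat) : tv :=
  if `[< I <> [set 0] >] then kand (kand (mc w I i i) (val i)) (knot (tp w i))
  else ff3.

Definition c_adj (w : word) (I : set rat) (val : nat -> tv) (i j : nat) : tv :=
  kand (kand (kand (mc w I (maxn i j) (minn i j)) (val j)) (tp w j)) (tp w i).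

Definition c_skip (w : word) (I : set rat) (val : nat -> tv) (i k j : nat) :
    tv :=
  kand (kand (mc w I (maxn i j) (minn i j)) (val j)) (knot (tp w k)).

Fixpoint sem (phi : mtl) (w : word) (i : nat) (nu : valuation) {struct phi} :
    tv :=
  match phi with
  | FTrue => tt3
  | FPred p xs =>
      match (lett w i).1 p, eval_vars nu xs with
      | Some rel, Some ds => Some `[< rel ds >]
      | _, _ => bot3
      end
  (* if the register is undefined, so is [x] in the updated valuation *)
  | FFreeze r x phi => sem phi w i (upd nu x ((lett w i).2 r))
  | FNot phi => knot (sem phi w i nu)
  | FOr phi psi => kor (sem phi w i nu) (sem psi w i nu)
  | FPrev J phi =>
      let val j := sem phi w j nu in
      kor (kor (c_self w J val i)
               (if (1 <= i)%N then c_adj w J val i (i - 1) else ff3))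
          (if (2 <= i)%N then c_skip w J val i (i - 1) (i - 2) else ff3)
  | FNext J phi =>
      let val j := sem phi w j nu in
      kor (kor (c_self w J val i)
               (if (i + 1 < size w)%N then c_adj w J val i (i + 1) else ff3))
          (if (i + 2 < size w)%N then c_skip w J val i (i + 1) (i + 2) else ff3)
  | FSince J phi psi =>
      \big[kor/ff3]_(0 <= j < i.+1)
        kand (kand (kand (tp w j) (mc w J i j)) (sem psi w j nu))
             (\big[kand/tt3]_(j.+1 <= k < i.+1)
                kimpl (tp w k) (sem phi w k nu))
  | FUntil J phi psi =>
      \big[kor/ff3]_(i <= j < size w)
        kand (kand (kand (tp w j) (mc w J j i)) (sem psi w j nu))
             (\big[kand/tt3]_(i <= k < j)
                kimpl (tp w k) (sem phi w k nu))
  end.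

(** The intervals of an observation are pairwise disjoint, so at most one
    position can be picked. *)
Definition sem_at (phi : mtl) (w : word) (t : rat) (nu : valuation) : tv :=
  if [pick i : 'I_(size w) | `[< ival w i = [set t] >]] is Some i
  then sem phi w i nu else bot3.

End MTL.

(* Main.v *)
(** In an observation the intervals are nonempty and increasing, and no two
    adjacent positions are non-time points; every step preserves this.  If [v]
    refines [u], each interval of [v] lies in a unique interval of [u], its
    ancestor, and each time point of [u] has exactly one descendant in [v].  The
    ancestor map is monotone, so the three-valued semantics at a position of [v]
    refines the one at its ancestor, by induction on the formula.  For previous
    and next, the ancestors of two neighbouring positions are at distance at most
    two, because the positions skipped between them are pairwise nonadjacent;
    each such distance is accounted for by one of the three disjuncts. *)

Require Import Defs.
From mathcomp Require Import all_boot all_order all_algebra.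
From mathcomp Require Import boolp classical_sets set_interval num_normedtype.
From mathcomp Require Import zify lra.
From Stdlib Require Import Relation_Operators.

Set Implicit Arguments.
Unset Strict Implicit.
Unset Printing Implicit Defensive.

Import Order.TTheory GRing.Theory Num.Theory.
Local Open Scope classical_set_scope.
Local Open Scope ring_scope.

(** * Strong Kleene connectives and the knowledge order *)

Lemma kleP (a b : tv) : kle a b <-> forall c, a = Some c -> b = Some c.
Proof.
rewrite /kle /klt; split=> [[->|[-> _]] //|].
by case: a => [c h|_]; [left; rewrite (h c)|case: b => [[]|]; auto].
Qed.

Lemma kle_refl a : kle a a.
Proof. by left. Qed.

Lemma kle_not a b : kle a b -> kle (knot a) (knot b).
Proof. by case=> [->|[-> _]]; apply/kleP. Qed.

Lemma kle_or a a' b b' : kle a a' -> kle b b' -> kle (kor a b) (kor a' b').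
Proof.
move=> /kleP + /kleP; rewrite kleP.
by case: a => [[]|]; case: b => [[]|] // h1 h2 c;
  rewrite ?(h1 _ erefl) ?(h2 _ erefl) //=; case: a' {h1} => [[]|].
Qed.

Lemma kandT a b : kand a b = Some true <-> a = Some true /\ b = Some true.
Proof. by case: a => [[]|]; case: b => [[]|]; split=> // -[]. Qed.

Lemma kandF a b : kand a b = Some false <-> a = Some false \/ b = Some false.
Proof. by case: a => [[]|]; case: b => [[]|]; split=> //; auto; case. Qed.

Lemma korT a b : kor a b = Some true <-> a = Some true \/ b = Some true.
Proof. by case: a => [[]|]; case: b => [[]|]; split=> //; auto; case. Qed.

Lemma korF a b : kor a b = Some false <-> a = Some false /\ b = Some false.
Proof. by case: a => [[]|]; case: b => [[]|]; split=> // -[]. Qed.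

Lemma knotT a : knot a = Some true <-> a = Some false.
Proof. by case: a => [[]|]. Qed.

Lemma knotF a : knot a = Some false <-> a = Some true.
Proof. by case: a => [[]|]. Qed.

Lemma big_korT (r : seq nat) F :
  \big[kor/Some false]_(j <- r) F j = Some true <->
  exists2 j, j \in r & F j = Some true.
Proof.
elim: r => [|x r IH]; first by rewrite big_nil; split=> // -[].
rewrite big_cons korT IH; split=> [[h|[j jr h]]|[j]].
- by exists x; rewrite ?mem_head.
- by exists j; rewrite // inE jr orbT.
- by rewrite inE => /predU1P[->|jr h]; [left|right; exists j].
Qed.

Lemma big_korF (r : seq nat) F :
  \big[kor/Some false]_(j <- r) F j = Some false <->
  forall j, j \in r -> F j = Some false.
Proof.
elim: r => [|x r IH]; first by rewrite big_nil.
rewrite big_cons korF IH; split=> [[h hr] j|h].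
  by rewrite inE => /predU1P[->|/hr].
by split=> [|j jr]; apply: h; rewrite inE ?eqxx ?jr ?orbT.
Qed.

Lemma big_kandT (r : seq nat) F :
  \big[kand/Some true]_(j <- r) F j = Some true <->
  forall j, j \in r -> F j = Some true.
Proof.
elim: r => [|x r IH]; first by rewrite big_nil.
rewrite big_cons kandT IH; split=> [[h hr] j|h].
  by rewrite inE => /predU1P[->|/hr].
by split=> [|j jr]; apply: h; rewrite inE ?eqxx ?jr ?orbT.
Qed.

Lemma big_kandF (r : seq nat) F :
  \big[kand/Some true]_(j <- r) F j = Some false <->
  exists2 j, j \in r & F j = Some false.
Proof.
elim: r => [|x r IH]; first by rewrite big_nil; split=> // -[].
rewrite big_cons kandF IH; split=> [[h|[j jr h]]|[j]].
- by exists x; rewrite ?mem_head.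
- by exists j; rewrite // inE jr orbT.
- by rewrite inE => /predU1P[->|jr h]; [left|right; exists j].
Qed.

(** Common core of since and until: [e j i] means that index [i] on the refined
    side descends from index [j]. *)
Lemma kle_since (e : nat -> nat -> Prop) (ru rv : seq nat)
    (Ku Kv : nat -> seq nat) (Tu Tv Mu Mv Qu Qv Fu Fv : nat -> tv) :
  (forall j, Tu j <> Some false) ->
  (forall j i, e j i -> kle (Tu j) (Tv i)) ->
  (forall j i, j \in ru -> i \in rv -> e j i -> kle (Mu j) (Mv i)) ->
  (forall j i, e j i -> kle (Qu j) (Qv i)) ->
  (forall j i, e j i -> kle (Fu j) (Fv i)) ->
  (forall i, i \in rv -> exists2 j, j \in ru & e j i) ->
  (forall j, j \in ru -> Tu j = Some true -> exists2 i, i \in rv & e j i) ->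
  (forall j i k, j \in ru -> i \in rv -> e j i -> Tu j = Some true ->
     k \in Kv i -> exists2 k', k' \in Ku j & e k' k) ->
  (forall j i k', j \in ru -> i \in rv -> e j i -> k' \in Ku j ->
     Tu k' = Some true -> exists2 k, k \in Kv i & e k' k) ->
  kle (\big[kor/Some false]_(j <- ru)
         kand (kand (kand (Tu j) (Mu j)) (Qu j))
              (\big[kand/Some true]_(k <- Ku j) kimpl (Tu k) (Fu k)))
      (\big[kor/Some false]_(i <- rv)
         kand (kand (kand (Tv i) (Mv i)) (Qv i))
              (\big[kand/Some true]_(k <- Kv i) kimpl (Tv k) (Fv k))).
Proof.
move=> nF eT eM eQ eF anc desc K1 K2; rewrite kleP => -[].
  move=> /big_korT[j jr /kandT[/kandT[/kandT[Tj Mj] Qj] /big_kandT Fj]].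
  apply/big_korT; have [i ir eji] := desc j jr Tj; exists i => //.
  apply/kandT; split.
    apply/kandT; split; last by move/kleP: (eQ _ _ eji); apply.
    apply/kandT; split; first by move/kleP: (eT _ _ eji); apply.
    by move/kleP: (eM _ _ jr ir eji); apply.
  apply/big_kandT => k kK; have [k' /Fj + ek] := K1 _ _ _ jr ir eji Tj kK.
  (* [Tu] is never false, so a true implication has a true conclusion, even at an index that is not
     a time point. *)
  move=> /korT[/knotT /nF //|Fk]; apply/korT; right.
  by move/kleP: (eF _ _ ek); apply.
move/big_korF => hu; apply/big_korF => i ir; have [j jr eji] := anc i ir.
have /kandF[/kandF[/kandF[/nF//|Mj]|Qj]|/big_kandF[k' kK]] := hu j jr.
- apply/kandF; left; apply/kandF; left; apply/kandF; right.
  by move/kleP: (eM _ _ jr ir eji); apply.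
- apply/kandF; left; apply/kandF; right.
  by move/kleP: (eQ _ _ eji); apply.
- move=> /korF[/knotF Tk Fk]; have [k kKv ek] := K2 _ _ _ jr ir eji kK Tk.
  apply/kandF; right; apply/big_kandF; exists k => //; apply/korF; split.
    by apply/knotF; move/kleP: (eT _ _ ek); apply.
  by move/kleP: (eF _ _ ek); apply.
Qed.

(** * Well-formed words and embeddings *)

Lemma In_cat (T : Type) (x : T) (s1 s2 : seq T) :
  List.In x (s1 ++ s2) <-> List.In x s1 \/ List.In x s2.
Proof. exact: List.in_app_iff. Qed.

Definition singleton (I : set rat) := exists t, I = [set t].

(** The shape of the non-singleton intervals of an observation. *)
Definition right_open (I : set rat) :=
  [/\ is_interval I, I !=set0, forall x, I x -> 0 <= x,
      forall x, I x -> 0 < x -> exists2 y, I y & y < x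
    & forall x, I x -> exists2 y, I y & x < y].

Definition precedes (I J : set rat) := forall x y, I x -> J y -> x < y.

Section Words.
Variables (P R : finType) (D : Type) (iota : P -> nat).
Local Notation word := (word R D iota).
Local Notation letter := (letter R D iota).
Implicit Types (u v w : word) (I J : set rat) (a b : letter).

Definition well_shaped (p : set rat * letter) :=
  `[< singleton p.1 \/ right_open p.1 >].
Definition prec (p q : set rat * letter) := `[< precedes p.1 q.1 >].
Definition tp_adj (p q : set rat * letter) :=
  `[< singleton p.1 >] || `[< singleton q.1 >].

Definition wf w := [/\ all well_shaped w, pairwise prec w & sorted tp_adj w].

(** What survives of [refines] when the order of the transformations is forgotten. It mentions
    letters but no positions, which makes composition immediate; well-formedness recovers the
    positions later. [List.In] serves because [D] is an arbitrary type without [eqType]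
    structure. *)
Definition emb u v :=
  (forall q, List.In q v ->
     exists p, [/\ List.In p u, q.1 `<=` p.1 & letter_le p.2 q.2]) /\
  (forall t a, List.In ([set t], a) u -> exists b, List.In ([set t], b) v).

Lemma letter_le_refl a : letter_le a a.
Proof. by split. Qed.
#[local] Hint Resolve letter_le_refl : core.

Lemma letter_le_trans a b (c : letter) :
  letter_le a b -> letter_le b c -> letter_le a c.
Proof.
by move=> [ab1 ab2] [bc1 bc2]; split=> x y; [move=> /ab1/bc1|move=> /ab2/bc2].
Qed.

Lemma emb_refl u : emb u u.
Proof.
by split=> [q uq|t a ua]; [exists q; split|exists a].
Qed.

Lemma emb_trans u v w : emb u v -> emb v w -> emb u w.
Proof.
move=> [A1 A2] [B1 B2]; split=> [r /B1[q [/A1[p [pu qp pq]] rq qr]]|t a].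
  by exists p; split=> //; [exact: subset_trans qp|exact: letter_le_trans qr].
by move=> /A2[b /B2].
Qed.

(** Each transformation replaces one letter by a block [s]: two or three letters for T1, none for
    T2, one for T3. The second hypothesis is vacuous unless [I] is a singleton, so it matters for T3
    only. *)
Lemma emb_subst w1 w2 I a (s : word) :
  (forall q, List.In q s -> q.1 `<=` I /\ letter_le a q.2) ->
  (forall t, I = [set t] -> exists b, List.In ([set t], b) s) ->
  emb (w1 ++ (I, a) :: w2) (w1 ++ s ++ w2).
Proof.
move=> hs ht; split=> [q /In_cat[q1|/In_cat[qs|q2]]|t b].
- by exists q; split=> //; apply/In_cat; left.
- by exists (I, a); have [? ?] := hs q qs; split=> //;
    apply/In_cat; right; left.
- by exists q; split=> //; apply/In_cat; right; right.
- move=> /In_cat[h|[[/ht[c h] _]|h]]; [exists b|exists c|exists b].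
  + by apply/In_cat; left.
  + by apply/In_cat; right; apply/In_cat; left.
  + by apply/In_cat; right; apply/In_cat; right.
Qed.

Lemma pairwise_prec_subst w1 w2 I a (s : word) :
  pairwise prec (w1 ++ (I, a) :: w2) ->
  all (fun q => `[< q.1 `<=` I >]) s -> pairwise prec s ->
  pairwise prec (w1 ++ s ++ w2).
Proof.
rewrite !pairwise_cat /= allrel_consr allrel_catr.
move=> /and3P[/andP[h1 ->] -> /andP[h2 ->]] hs ->; rewrite !andbT /=.
apply/andP; split.
  apply: sub_all h1 => x /asboolP xI; apply: sub_all hs => q /asboolP qI.
  by apply/asboolP => y z hy /qI; apply: xI.
apply: sub_all hs => q /asboolP qI; apply: sub_all h2 => x /asboolP xI.
by apply/asboolP => y z /qI hy; apply: xI.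
Qed.

(** * Intervals and adjacency under the transformations *)

Lemma singleton_not_right_open I : singleton I -> right_open I -> False.
Proof.
by move=> [t ->] [_ _ _ _ /(_ t erefl)[y]] /= ->; rewrite ltxx.
Qed.

Lemma is_subset1_right_open I :
  ~ is_subset1 I -> singleton I \/ right_open I -> right_open I.
Proof. by move=> nI [[t It]|//]; case: nI => x y; rewrite It /= => -> ->. Qed.

(** [I] has no positive minimum, so a point below [t] remains; no maximum appears, because midpoints
    with [t] stay in [I] by convexity. *)
Lemma right_open_lt I t : right_open I -> I t -> 0 < t ->
  right_open (I `&` `[0, t[).
Proof.
move=> [cI nI I0 Il Ir] It t0; have [y Iy yt] := Il t It t0.
split.
- move=> x z [Ix /=]; rewrite in_itv /= => /andP[x0 xt] [Iz /=].
  rewrite in_itv /= => /andP[z0 zt] s /andP[xs sz]; split.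
    by apply: (cI x z) => //; rewrite xs sz.
  by rewrite /= in_itv /= (le_trans x0 xs) (le_lt_trans sz zt).
- by exists y; split=> //; rewrite /= in_itv /= yt I0.
- by move=> x [/I0].
- move=> x [Ix /=]; rewrite in_itv /= => /andP[_ xt] x0.
  have [z Iz zx] := Il x Ix x0; exists z => //; split=> //=.
  by rewrite in_itv /= I0 // (lt_trans zx).
- move=> x [Ix /=]; rewrite in_itv /= => /andP[x0 xt].
  exists ((x + t) / 2); last by lra.
  split; first by apply: (cI x t) => //; lra.
  by rewrite /= in_itv /=; lra.
Qed.

Lemma right_open_gt I t : right_open I -> I t -> right_open (I `&` `]t, +oo[).
Proof.
move=> [cI nI I0 Il Ir] It; have [y Iy yt] := Ir t It; split.
- move=> x z [Ix /=]; rewrite in_itv /= andbT => xt [Iz /=].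
  rewrite in_itv /= andbT => zt s /andP[xs sz]; split.
    by apply: (cI x z) => //; rewrite xs sz.
  by rewrite /= in_itv /= (lt_le_trans xt xs).
- by exists y; split=> //; rewrite /= in_itv /= yt.
- by move=> x [/I0].
- move=> x [Ix /=]; rewrite in_itv /= andbT => tx _.
  exists ((x + t) / 2); last by lra.
  split; first by apply: (cI t x) => //; lra.
  by rewrite /= in_itv /= andbT; lra.
- move=> x [Ix /=]; rewrite in_itv /= andbT => tx.
  have [z Iz xz] := Ir x Ix; exists z => //; split=> //=.
  by rewrite in_itv /= (lt_trans tx).
Qed.

(** Both neighbours of a non-singleton interval are time points, so they may become adjacent. *)
Lemma sorted_tp_adj_remove w1 w2 I a : ~ singleton I ->
  sorted tp_adj (w1 ++ (I, a) :: w2) -> sorted tp_adj (w1 ++ w2).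
Proof.
move=> nI; rewrite sorted_cat_cons; case: w1 => [|p w1] /=.
  by case: w2 => //= q w2 /andP[].
rewrite rcons_path cat_path => /andP[/andP[-> ]].
rewrite {1}/tp_adj /= (asboolF nI) orbF => h.
by case: w2 => //= q w2 /andP[_ ->]; rewrite andbT /tp_adj h.
Qed.

Lemma sorted_tp_adj_tp w1 w2 I t a b : singleton I ->
  sorted tp_adj (w1 ++ (I, a) :: w2) ->
  sorted tp_adj (w1 ++ ([set t], b) :: w2).
Proof.
move=> sI; have st : singleton [set t] by exists t.
rewrite !sorted_cat_cons => /andP[h1 h2]; apply/andP; split.
  case: w1 h1 => //= p w1; rewrite !rcons_path => /andP[-> _] /=.
  by rewrite /tp_adj /= (asboolT st) orbT.
by case: w2 h2 => //= q w2 /andP[_ ->]; rewrite /tp_adj /= (asboolT st).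
Qed.

(** The new time point separates the outer pieces, and these inherit the neighbours of [I], which
    are time points. *)
Lemma sorted_tp_adj_split w1 w2 I J K t a : ~ singleton I ->
  sorted tp_adj (w1 ++ (I, a) :: w2) ->
  sorted tp_adj (w1 ++ [:: (J, a); ([set t], a); (K, a)] ++ w2).
Proof.
move=> nI; have st : singleton [set t] by exists t.
rewrite /= !sorted_cat_cons => /andP[h1 h2]; apply/andP; split.
  case: w1 h1 => //= p w1; rewrite !rcons_path => /andP[-> ] /=.
  by rewrite /tp_adj /= (asboolF nI) orbF => ->.
rewrite /= /tp_adj /= (asboolT st) orbT /=.
case: w2 h2 => //= q w2 /andP[+ ->].
by rewrite /tp_adj /= (asboolF nI) /= => ->; rewrite orbT.
Qed.

(** The new time point comes first, so only the right neighbour of [I] has to be a time point. *)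
Lemma sorted_tp_adj_split0 w1 w2 I K t a : ~ singleton I ->
  sorted tp_adj (w1 ++ (I, a) :: w2) ->
  sorted tp_adj (w1 ++ [:: ([set t], a); (K, a)] ++ w2).
Proof.
move=> nI; have st : singleton [set t] by exists t.
rewrite /= !sorted_cat_cons => /andP[h1 h2]; apply/andP; split.
  case: w1 h1 => //= p w1; rewrite !rcons_path => /andP[-> _] /=.
  by rewrite /tp_adj /= (asboolT st) orbT.
rewrite /= /tp_adj /= (asboolT st) /=.
case: w2 h2 => //= q w2 /andP[+ ->].
by rewrite /tp_adj /= (asboolF nI) /= => ->; rewrite orbT.
Qed.

(** The interval [[0, +oo[] contains its minimum 0; for this reason [right_open] excludes only
    positive minima. *)
Lemma wf_init : wf (init_word R D iota).
Proof.
split=> //=; rewrite andbT; apply/asboolP; right; split.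
- by apply: interval_is_interval.
- by exists 0; rewrite /= in_itv.
- by move=> x /=; rewrite in_itv /= andbT.
- by move=> x /= _ x0; exists 0; rewrite //= in_itv.
- move=> x /=; rewrite in_itv /= andbT => x0.
  by exists (x + 1); rewrite /= ?in_itv /=; lra.
Qed.

(** * Preservation by the transformations *)

Lemma well_shaped_subst w1 w2 I a (s : word) :
  all well_shaped (w1 ++ (I, a) :: w2) -> all well_shaped s ->
  all well_shaped (w1 ++ s ++ w2).
Proof. by rewrite !all_cat /= => /and3P[-> _ ->] ->. Qed.

Lemma well_shaped_mid w1 w2 I a :
  all well_shaped (w1 ++ (I, a) :: w2) -> singleton I \/ right_open I.
Proof. by rewrite all_cat /= => /and3P[_ /asboolP]. Qed.

Lemma wf_step u v : wf u -> step u v -> wf v /\ emb u v.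
Proof.
move=> + uv; case: uv => [w1 w2 I a t nI It t0|w1 w2 I a nI I0|w1 w2 I a nI _|
    w1 w2 t a a' aa'] [sh pr so].
- have oI := is_subset1_right_open nI (well_shaped_mid sh).
  have nsI : ~ singleton I by move=> /singleton_not_right_open; apply.
  have sub0 : I `&` `[0, t[ `<=` I by move=> ? [].
  have sub1 : [set t] `<=` I by move=> ? ->.
  have sub2 : I `&` `]t, +oo[ `<=` I by move=> ? [].
  split; first split.
  + apply: well_shaped_subst sh _ => /=; apply/and4P; split=> //.
    * by apply/asboolP; right; apply: right_open_lt.
    * by apply/asboolP; left; exists t.
    * by apply/asboolP; right; apply: right_open_gt.
  + apply: pairwise_prec_subst pr _ _ => /=.
      by rewrite !asboolT.
    have h1 : precedes (I `&` `[0, t[) [set t].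
      by move=> x y [_ /=]; rewrite in_itv /= => /andP[_ ?] ->.
    have h2 : precedes [set t] (I `&` `]t, +oo[).
      by move=> x y -> [_ /=]; rewrite in_itv /= andbT.
    rewrite /prec /= !asboolT // => x y xI yI.
    by apply: lt_trans (h2 t y erefl yI); apply: h1 xI erefl.
  + exact: sorted_tp_adj_split so.
  + apply: emb_subst => [q|r Ir]; last by case: nsI; exists r.
    by move=> /= [<-|[<-|[<-|//]]]; split.
- have oI := is_subset1_right_open nI (well_shaped_mid sh).
  have nsI : ~ singleton I by move=> /singleton_not_right_open; apply.
  have sub1 : [set 0] `<=` I by move=> ? ->.
  have sub2 : I `&` `]0, +oo[ `<=` I by move=> ? [].
  split; first split.
  + apply: well_shaped_subst sh _ => /=; apply/and3P; split=> //.
    * by apply/asboolP; left; exists 0.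
    * by apply/asboolP; right; apply: right_open_gt.
  + apply: pairwise_prec_subst pr _ _ => /=.
      by rewrite !asboolT.
    rewrite /prec /= !asboolT // => x y -> [_ /=].
    by rewrite in_itv /= andbT.
  + exact: sorted_tp_adj_split0 so.
  + apply: emb_subst => [q|r Ir]; last by case: nsI; exists r.
    by move=> /= [<-|[<-|//]]; split.
- have oI := is_subset1_right_open nI (well_shaped_mid sh).
  have nsI : ~ singleton I by move=> /singleton_not_right_open; apply.
  split; first split.
  + exact: (@well_shaped_subst w1 w2 I a [::]).
  + exact: (@pairwise_prec_subst w1 w2 I a [::]).
  + exact: sorted_tp_adj_remove so.
  + by apply: (@emb_subst w1 w2 I a [::]) => [q|r Ir] //; case: nsI; exists r.
- split; first split.
  + apply: (@well_shaped_subst w1 w2 [set t] a [:: _]) => //=.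
    by rewrite andbT; apply/asboolP; left; exists t.
  + apply: (@pairwise_prec_subst w1 w2 [set t] a [:: _]) => //=.
    by rewrite andbT; apply/asboolP.
  + by apply: sorted_tp_adj_tp so; exists t.
  + apply: (@emb_subst w1 w2 [set t] a [:: _]) => [q [<-|//]|r rt].
      by split.
    by exists a'; left; rewrite rt.
Qed.

Lemma wf_refines u v : wf u -> refines u v -> wf v /\ emb u v.
Proof.
move=> + uv; elim: uv => {u v} [u v uv wu|u wu|u v w _ IH1 _ IH2 wu].
- exact: wf_step uv.
- by split=> //; apply: emb_refl.
- have [wv uv] := IH1 wu; have [ww vw] := IH2 wv.
  by split=> //; apply: emb_trans vw.
Qed.

Lemma wf_observation w : observation w -> wf w.
Proof. by move=> /(wf_refines wf_init)[]. Qed.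

(** * Positions of a well-formed word *)

Lemma In_ival w p : List.In p w ->
  exists2 i, (i < size w)%N & ival w i = p.1 /\ lett w i = p.2.
Proof.
elim: w => //= q w IH [->|/IH[i iw h]]; first by exists 0%N.
by exists i.+1.
Qed.

Lemma ival_In w i : (i < size w)%N -> List.In (ival w i, lett w i) w.
Proof.
elim: w i => //= q w IH [_|i /IH]; last by right.
by left; rewrite /ival /lett /=; case: q.
Qed.

Lemma ival_neq0 w i : wf w -> (i < size w)%N -> ival w i !=set0.
Proof.
move=> [/(all_nthP (set0, letter0 R D iota)) h _ _] /h /asboolP[[t]|[]//].
by rewrite /ival => ->; exists t.
Qed.

Lemma ival_lt w i j x y : wf w -> (i < j < size w)%N ->
  ival w i x -> ival w j y -> x < y.
Proof.
move=> [_ /(pairwiseP (set0, letter0 R D iota)) h _] /andP[ij jw].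
have /asboolP := h i j (ltn_trans ij jw) jw ij; exact.
Qed.

Lemma ival_inj w i j x : wf w -> (i < size w)%N -> (j < size w)%N ->
  ival w i x -> ival w j x -> i = j.
Proof.
move=> ww iw jw xi xj; case: (ltngtP i j) => // ij.
  by have := ival_lt ww (introT andP (conj ij jw)) xi xj; rewrite ltxx.
by have := ival_lt ww (introT andP (conj ij iw)) xj xi; rewrite ltxx.
Qed.

Lemma wf_alternate w i : wf w -> (i.+1 < size w)%N ->
  is_tp w i \/ is_tp w i.+1.
Proof.
move=> [_ _ /(sortedP (set0, letter0 R D iota)) h] /h /orP[]/asboolP; auto.
Qed.

Lemma tpT w i : tp w i = Some true <-> is_tp w i.
Proof. by rewrite /tp; case: asboolP. Qed.

Lemma tpNF w i : tp w i <> Some false.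
Proof. by rewrite /tp; case: asboolP. Qed.

End Words.

(** * The ancestor relation between positions *)

Section Monotonicity.
Variables (P R : finType) (V : eqType) (D : Type) (iota : P -> nat).
Local Notation word := (word R D iota).
Variables (u v : word).
Hypotheses (wu : wf u) (wv : wf v) (uv : emb u v).

(** The letter at position [i] of [v] descends from the one at [j] of [u]. *)
Definition anc (j i : nat) :=
  [/\ (j < size u)%N, (i < size v)%N, ival v i `<=` ival u j
    & letter_le (lett u j) (lett v i)].

Lemma anc_exists i : (i < size v)%N -> exists j, anc j i.
Proof.
move=> iv; have [A1 _] := uv; have [p [pu sub le]] := A1 _ (ival_In iv).
have [j ju [ej lj]] := In_ival pu.
by exists j; split=> //; rewrite ?ej ?lj.
Qed.

(** For [i < i'], points of the two intervals would be ordered both ways if [j' < j]. The case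
    [i = i'] rests on disjointness in [u] and contains the uniqueness of the ancestor. *)
Lemma anc_monotone j i j' i' :
  anc j i -> anc j' i' -> (i <= i')%N -> (j <= j')%N.
Proof.
move=> [ju iv sub _] [ju' iv' sub' _]; rewrite leq_eqVlt => /predU1P[ii|ii].
  have [x xi] := ival_neq0 wv iv.
  have xj : ival u j' x by apply: sub'; rewrite -ii.
  by rewrite (ival_inj wu ju ju' (sub _ xi) xj).
rewrite leqNgt; apply/negP => jj.
have [x xi] := ival_neq0 wv iv; have [y yi] := ival_neq0 wv iv'.
have xy := ival_lt wv (introT andP (conj ii iv')) xi yi.
have := ival_lt wu (introT andP (conj jj ju)) (sub' _ yi) (sub _ xi).
by move=> /(lt_trans xy); rewrite ltxx.
Qed.

Lemma anc_tp j i : anc j i -> is_tp u j -> ival v i = ival u j.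
Proof.
move=> [_ iv sub _] [t jt]; rewrite jt in sub *.
have [x xi] := ival_neq0 wv iv; have xt := sub _ xi; rewrite /= in xt.
by apply/seteqP; split=> // y ->; rewrite -xt.
Qed.

Lemma is_tp_anc j i : anc j i -> is_tp u j -> is_tp v i.
Proof. by move=> ji /[dup] tj [t jt]; exists t; rewrite (anc_tp ji tj). Qed.

Lemma anc_tp_inj j i i' : anc j i -> anc j i' -> is_tp u j -> i = i'.
Proof.
move=> ji ji' tj; have ei := anc_tp ji tj; have ei' := anc_tp ji' tj.
have [[_ iv _ _] [_ iv' _ _]] := (ji, ji').
have [x xi] := ival_neq0 wv iv.
by apply: (ival_inj wv iv iv' xi); rewrite ei' -ei.
Qed.

Lemma tp_desc j : (j < size u)%N -> is_tp u j -> exists i, anc j i.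
Proof.
move=> ju [t jt]; have [_ A2] := uv.
have := ival_In ju; rewrite jt => /A2[b /In_ival[i iv [/= it _]]].
(* [emb] yields a time point at [t] in [v] but does not relate its letter to the one at [j]. Its
   ancestor does, and this is [j] because both intervals contain [t]. *)
have [j' /[dup] ji' [ju' _ sub _]] := anc_exists iv.
suff -> : j = j' by exists i.
apply: (@ival_inj _ _ _ _ u j j' t) => //; first by rewrite jt.
by apply: sub; rewrite it.
Qed.

(** A common ancestor would be a time point with two descendants, so strictness carries over to
    [u]. *)
Lemma anc_tp_ltl j i j' i' :
  anc j i -> anc j' i' -> is_tp u j -> (i < i')%N -> (j < j')%N.
Proof.
move=> ji ji' tj ii; have := anc_monotone ji ji' (ltnW ii).
rewrite leq_eqVlt => /predU1P[jj|//]; rewrite -jj in ji'.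
by rewrite (anc_tp_inj ji ji' tj) ltnn in ii.
Qed.

Lemma anc_tp_ltr j i j' i' :
  anc j i -> anc j' i' -> is_tp u j' -> (i < i')%N -> (j < j')%N.
Proof.
move=> ji ji' tj ii; have := anc_monotone ji ji' (ltnW ii).
rewrite leq_eqVlt => /predU1P[jj|//]; rewrite jj in ji.
by rewrite (anc_tp_inj ji ji' tj) ltnn in ii.
Qed.

Lemma anc_lt j i j' i' : anc j i -> anc j' i' -> (j < j')%N -> (i < i')%N.
Proof.
move=> ji ji' jj; rewrite ltnNge; apply/negP => /(anc_monotone ji' ji).
by rewrite leqNgt jj.
Qed.

(** Positions of [u] skipped by two neighbours of [v] were removed, hence are
    non-time points, and no two of those are adjacent. *)
Lemma anc_gap j i j' i' : anc j' i' -> anc j i -> (i' < i)%N ->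
  (forall k, (i' < k < i)%N -> ~ is_tp v k) ->
  [\/ j' = j /\ ~ is_tp u j, j'.+1 = j | j'.+2 = j /\ ~ is_tp u j'.+1].
Proof.
move=> ji' ji ii ntp.
have nt m : (j' < m < j)%N -> ~ is_tp u m.
  move=> /andP[jm mj] tm; have [ju _ _ _] := ji.
  have [k mk] := tp_desc (ltn_trans mj ju) tm.
  apply: (ntp k); last exact: is_tp_anc mk tm.
  by rewrite (anc_lt ji' mk) ?(anc_lt mk ji).
have jj := anc_monotone ji' ji (ltnW ii).
have [gap|gap] := leqP j j'.+2.
  have [|[]] : j' = j \/ j'.+1 = j \/ j'.+2 = j by lia.
  - move=> ej; apply: Or31; split=> // tj; rewrite ej in ji'.
    by rewrite (anc_tp_inj ji' ji tj) ltnn in ii.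
  - exact: Or32.
  - by move=> ej; apply: Or33; split=> //; apply: nt; lia.
(* At distance three or more, [j'.+1] and [j'.+2] are both skipped, yet one of them is a time
   point. *)
have [ju _ _ _] := ji; have /(wf_alternate wu)[] : (j'.+2 < size u)%N by lia.
- by move=> /nt; case; lia.
- by move=> /nt; case; lia.
Qed.

(** * Metric constraints under refinement *)

Lemma mc_anc (I : set rat) j i j' i' : anc j i -> anc j' i' -> (i' <= i)%N ->
  kle (mc u I j j') (mc v I i i').
Proof.
move=> [ju iv sub _] [ju' iv' sub' _] ii.
(* Refinement shrinks the difference set, which preserves both inclusion in [I] and disjointness
   from [I]. *)
have dsub : qdiff (ival v i) (ival v i') `<=` qdiff (ival u j) (ival u j').
  by move=> x [x0 [a [b [/sub ? [/sub' ? ?]]]]]; split=> //; exists a, b.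
(* Without a point in the smaller set, a true constraint would turn false; [i' <= i] provides
   one. *)
have d0 : qdiff (ival v i) (ival v i') !=set0.
  have [x xi] := ival_neq0 wv iv; have [y yi] := ival_neq0 wv iv'.
  move: ii; rewrite leq_eqVlt => /predU1P[ii|ii].
    by exists 0; split=> //; exists x, x; rewrite subrr ii.
  exists (x - y); split; last by exists x, y.
  by rewrite subr_ge0 ltW // (ival_lt wv (introT andP (conj ii iv)) yi xi).
rewrite /mc; case: asboolP => [[_ dI]|_].
  rewrite asboolT; first exact: kle_refl.
  by split=> //; apply: subset_trans dI.
case: asboolP => [dI|_]; last by apply/kleP.
have dI' : qdiff (ival v i) (ival v i') `&` I = set0.
  by apply/seteqP; split=> // x [/dsub dx Ix]; rewrite -dI.
rewrite asboolF ?asboolT; first exact: kle_refl; first exact: dI'.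
move=> [[x dx] dI2].
have : (qdiff (ival v i) (ival v i') `&` I) x by split=> //; apply: dI2.
by rewrite dI'.
Qed.

(** Distinct positions are at positive distance. This settles the interval [[set 0]], where [c_self]
    is false by its side condition and says nothing about the operand. *)
Lemma mc_zero i i' : (i' < i < size v)%N -> mc v [set 0] i i' = Some false.
Proof.
move=> /[dup] lt /andP[ii iv]; have iv' := ltn_trans ii iv.
have d0 : qdiff (ival v i) (ival v i') `&` [set 0] = set0.
  apply/seteqP; split=> // z [[_ [a [b [ai [bi ->]]]]] /= /eqP].
  by rewrite subr_eq0 => /eqP ab; have := ival_lt wv lt bi ai; rewrite ab ltxx.
rewrite /mc asboolF ?asboolT // => -[[x dx] dI2].
have : (qdiff (ival v i) (ival v i') `&` [set 0]) x by split=> //; apply: dI2.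
by rewrite d0.
Qed.

Lemma mc_maxn (I : set rat) j i j' i' : anc j i -> anc j' i' ->
  kle (mc u I (maxn j j') (minn j j')) (mc v I (maxn i i') (minn i i')).
Proof.
move=> ji ji'; case: (leqP i i') => [|/ltnW] ii.
  have jj := anc_monotone ji ji' ii.
  by rewrite (maxn_idPr jj) (minn_idPl jj); apply: mc_anc.
have jj := anc_monotone ji' ji ii.
by rewrite (maxn_idPl jj) (minn_idPr jj); apply: mc_anc.
Qed.

Lemma tp_anc j i : anc j i -> kle (tp u j) (tp v i).
Proof.
by move=> ji; apply/kleP => -[] => [/tpT/(is_tp_anc ji)/tpT|/tpNF].
Qed.

(** Common core of previous and next, with [k] the adjacent position and [l] the
    one after it, subject to the side conditions [c] and [d]. *)
Definition shift (w : word) (I : set rat) (val : nat -> tv) i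
    (c d : bool) (k l : nat) :=
  kor (kor (c_self w I val i) (if c then c_adj w I val i k else Some false))
      (if d then c_skip w I val i k l else Some false).

(** [reach] lists the ancestors that the three disjuncts at [j] account for; [anc_gap] will show
    that no others occur. A true value persists through [c_adj]; a false one refutes every disjunct
    at [i] through the ancestor of its position. *)
Lemma kle_shift (I : set rat) (fu fv : nat -> tv) j i
    (cu du : bool) ku lu (cv dv : bool) kv lv :
  let reach j' := [\/ j' = j /\ ~ is_tp u j, cu /\ j' = ku
                    | [/\ du, j' = lu & ~ is_tp u ku]] in
  anc j i -> (forall j' i', anc j' i' -> kle (fu j') (fv i')) ->
  (cu -> is_tp u j -> is_tp u ku -> cv /\ anc ku kv) ->
  (cv -> [/\ kv <> i, (kv < size v)%N & forall j', anc j' kv -> reach j']) ->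
  (dv -> [/\ lv <> i, (lv < size v)%N
           & ~ is_tp v kv -> forall j', anc j' lv -> reach j']) ->
  kle (shift u I fu j cu du ku lu) (shift v I fv i cv dv kv lv).
Proof.
move=> reach ji f adj hc hd; apply/kleP => -[].
  move=> /korT[/korT[|]|].
  (* [c_self] and [c_skip] contain a negated [tp], which is never true, so truth can come only from
     [c_adj]. *)
  - by rewrite /c_self; case: ifP => // _ /kandT[_ /knotT/tpNF].
  - case: ifP => // cuT /kandT[/kandT[/kandT[mcT fT] /tpT kT] /tpT jT].
    have [cvT kk] := adj cuT jT kT.
    apply/korT; left; apply/korT; right; rewrite cvT.
    apply/kandT; split; last by apply/tpT; apply: is_tp_anc jT.
    apply/kandT; split; last by apply/tpT; apply: is_tp_anc kT.
    apply/kandT; split; last by move/kleP: (f _ _ kk); apply.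
    by move/kleP: (mc_maxn I ji kk); apply.
  - by case: ifP => // _ /kandT[_ /knotT/tpNF].
move=> /korF[/korF[sF aF] kF].
have far x : x <> i -> (x < size v)%N -> (forall j', anc j' x -> reach j') ->
    kand (mc v I (maxn i x) (minn i x)) (fv x) = Some false.
  move=> xi xv hx; have [j' jx] := anc_exists xv; have {hx}r := hx _ jx.
  suff [I0|/kandF[mF|fF]] : I = [set 0] \/
      kand (mc u I (maxn j j') (minn j j')) (fu j') = Some false.
  - apply/kandF; left; rewrite I0; apply: mc_zero.
    by have [_ iv _ _] := ji; lia.
  - by apply/kandF; left; move/kleP: (mc_maxn I ji jx); apply.
  - by apply/kandF; right; move/kleP: (f _ _ jx); apply.
  (* The disjunct at [j] that covers [j'] is false while its time-point factors are not, so its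
     constraint or operand is; the exception is [c_self] for [[set 0]]. *)
  case: r => [[-> ntp]|[cuT ->]|[duT -> ntp]].
  - move: sF; rewrite /c_self; case: asboolP => [_|/contrapT]; last by left.
    by rewrite maxnn minnn => /kandF[|/knotF/tpT//]; right.
  - by move: aF; rewrite cuT => /kandF[/kandF[|/tpNF//]|/tpNF//]; right.
  - by move: kF; rewrite duT => /kandF[|/knotF/tpT//]; right.
apply/korF; split; first (apply/korF; split).
- move: sF; rewrite /c_self; case: ifP => // _ /kandF[/kandF[mF|fF]|/knotF tF].
  + apply/kandF; left; apply/kandF; left.
    by move/kleP: (mc_anc I ji ji (leqnn i)); apply.
  + by apply/kandF; left; apply/kandF; right; move/kleP: (f _ _ ji); apply.
  + by apply/kandF; right; apply/knotF; move/kleP: (tp_anc ji); apply.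
- case: ifP => // /hc[ki kv' r].
  by apply/kandF; left; apply/kandF; left; apply: far.
- case: ifP => // /hd[li lv' r]; apply/kandF.
  (* A time point in between makes [c_skip] false at once; otherwise [hd] locates the ancestors. *)
  have [kT|kN] := pselect (is_tp v kv).
    by right; apply/knotF/tpT.
  by left; apply: far => //; apply: r.
Qed.

(** * Induction on the formula *)

Lemma eval_vars_pext n (mu nu : valuation V D) (xs : n.-tuple V) ds :
  pext mu nu -> eval_vars mu xs = Some ds -> eval_vars nu xs = Some ds.
Proof.
move=> mn; rewrite /eval_vars; case: insubP => // t st tE [<-].
suff -> : pmap nu xs = pmap mu xs by rewrite -tE valK.
have : size (pmap mu xs) = size xs by rewrite (eqP st) size_tuple.
elim: (tval xs) => //= x s IH; case E: (mu x) => [d|] /=.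
  by rewrite (mn _ _ E) /= => -[/IH ->].
(* An undefined variable is dropped by [pmap], so the result would be too short. *)
move=> sz; have := size_pmap mu s; have := count_size (isSome \o mu) s.
by rewrite sz => h1 h2; rewrite -h2 ltnn in h1.
Qed.

Lemma sem_anc (phi : mtl R V iota) (mu nu : valuation V D) j i :
  pext mu nu -> anc j i -> kle (sem phi u j mu) (sem phi v i nu).
Proof.
elim: phi mu nu j i => [|p xs|r x phi IH|phi IH|phi IH1 psi IH2|I phi IH|
    I phi IH|I phi IH1 psi IH2|I phi IH1 psi IH2] mu nu j i mn ji /=.
- exact: kle_refl.
- have [_ _ _ [lp _]] := ji; apply/kleP => c.
  case E1: (_ p) => [rel|//]; case E2: eval_vars => [ds|//] <-.
  by rewrite (lp _ _ E1) (eval_vars_pext mn E2).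
- have [_ _ _ [_ lr]] := ji; apply: IH ji => y d; rewrite /upd.
  by case: eqP => _; [apply: lr|apply: mn].
- by apply: kle_not; apply: IH.
- by apply: kle_or; [apply: IH1|apply: IH2].
- have [ju iv _ _] := ji.
  apply: kle_shift => // [j' i' /IH-/(_ _ _ mn)//|j1 jT kT|i1|i2].
  (* The ancestor of [i - 1] is at least [j - 1], which has a descendant before [i], and differs
     from [j], which as a time point has only one descendant. *)
  + have [|k kj] := tp_desc _ kT; first by lia.
    have ki : (k < i)%N by apply: (anc_lt kj ji); lia.
    have [|j' ji'] := @anc_exists (i - 1); first by lia.
    have h1 : (j - 1 <= j')%N by apply: (anc_monotone kj ji'); lia.
    have h2 : (j' < j)%N by apply: (anc_tp_ltr ji' ji jT); lia.
    by split; [lia|have <- : j' = (j - 1)%N by lia].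
  + split; [lia|lia|move=> j' ji'].
    have [|k|[ej nj]|ej|[ej nj]] := anc_gap ji' ji; [lia|lia| | |].
    * exact: Or31.
    * by apply: Or32; lia.
    * by apply: Or33; rewrite -ej subn1 subn2.
  (* Only [i - 1] lies strictly between, and [nk] says that it is not a time point. *)
  + split; [lia|lia|move=> nk j' ji'].
    have [|k kr|[ej nj]|ej|[ej nj]] := anc_gap ji' ji; [lia| | | |].
    * by have -> : k = (i - 1)%N by lia.
    * exact: Or31.
    * by apply: Or32; lia.
    * by apply: Or33; rewrite -ej subn1 subn2.
- have [ju iv _ _] := ji.
  apply: kle_shift => // [j' i' /IH-/(_ _ _ mn)//|j1 jT kT|i1|i2].
  (* The descendant of [j + 1] comes after [i], so [i + 1] is a position of [v]; its ancestor lies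
     above [j] and is at most [j + 1]. *)
  + have [k kj] := tp_desc j1 kT; have [_ kv _ _] := kj.
    have ki : (i < k)%N by apply: (anc_lt ji kj); lia.
    have [|j' ji'] := @anc_exists (i + 1); first by lia.
    have h1 : (j' <= j + 1)%N by apply: (anc_monotone ji' kj); lia.
    have h2 : (j < j')%N by apply: (anc_tp_ltl ji ji' jT); lia.
    by split; [lia|have <- : j' = (j + 1)%N by lia].
  + split; [lia|lia|move=> j' ji']; have [ju' _ _ _] := ji'.
    have [|k|[ej nj]|ej|[ej nj]] := anc_gap ji ji'; [lia|lia| | |].
    * by apply: Or31; rewrite ej.
    * by apply: Or32; lia.
    * by apply: Or33; rewrite addn1 addn2 ej.
  + split; [lia|lia|move=> nk j' ji']; have [ju' _ _ _] := ji'.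
    have [|k kr|[ej nj]|ej|[ej nj]] := anc_gap ji ji'; [lia| | | |].
    * by have -> : k = (i + 1)%N by lia.
    * by apply: Or31; rewrite ej.
    * by apply: Or32; lia.
    * by apply: Or33; rewrite addn1 addn2 ej.
- have [ju iv _ _] := ji; apply: (kle_since (e := anc)).
  + by move=> k; apply: tpNF.
  + exact: tp_anc.
  + by move=> k' k _; rewrite mem_index_iota => ki kk; apply: mc_anc => //; lia.
  + by move=> k' k kk; apply: IH2.
  + by move=> k' k kk; apply: IH1.
  + move=> k; rewrite mem_index_iota => ki.
    have [|k' kk] := @anc_exists k; first by lia.
    exists k' => //; rewrite mem_index_iota ltnS.
    by rewrite (anc_monotone kk ji).
  (* Were the descendant beyond [i], the time point [k'] would lie beyond [j]. *)
  + move=> k'; rewrite mem_index_iota => ki /tpT kT.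
    have [|k kk] := tp_desc _ kT; first by lia.
    exists k => //; rewrite mem_index_iota ltnS /= leqNgt; apply/negP => ik.
    have := anc_tp_ltr ji kk kT ik; lia.
  (* The range excludes the witness: as [k'] is a time point, indices after [k] have ancestors
     strictly after [k']. *)
  + move=> k' k l _ _ kk /tpT kT; rewrite !mem_index_iota => li.
    have [|l' ll] := @anc_exists l; first by lia.
    exists l' => //; rewrite mem_index_iota ltnS.
    by rewrite (anc_monotone ll ji) ?(anc_tp_ltl kk ll kT); lia.
  + move=> k' k l' _ _ kk; rewrite !mem_index_iota => li /tpT lT.
    have [|l ll] := tp_desc _ lT; first by lia.
    exists l => //; rewrite mem_index_iota ltnS (anc_lt kk ll) /=; last by lia.
    rewrite leqNgt; apply/negP => il.
    have := anc_tp_ltr ji ll lT il; lia.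
- have [ju iv _ _] := ji; apply: (kle_since (e := anc)).
  + by move=> k; apply: tpNF.
  + exact: tp_anc.
  + by move=> k' k _; rewrite mem_index_iota => ki kk; apply: mc_anc => //; lia.
  + by move=> k' k kk; apply: IH2.
  + by move=> k' k kk; apply: IH1.
  + move=> k; rewrite mem_index_iota => ki.
    have [|k' kk] := @anc_exists k; first by lia.
    exists k' => //; have [ku _ _ _] := kk.
    by rewrite mem_index_iota ku (anc_monotone ji kk); lia.
  + move=> k'; rewrite mem_index_iota => ki /tpT kT.
    have [|k kk] := tp_desc _ kT; first by lia.
    exists k => //; have [_ kv _ _] := kk.
    rewrite mem_index_iota kv andbT leqNgt; apply/negP => ik.
    have := anc_tp_ltl kk ji kT ik; lia.
  (* Mirror image: indices before [k] have ancestors strictly before the time point [k']. *)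
  + move=> k' k l _ ki kk /tpT kT; rewrite !mem_index_iota in ki * => li.
    have [|l' ll] := @anc_exists l; first by lia.
    exists l' => //; rewrite mem_index_iota.
    by rewrite (anc_monotone ji ll) ?(anc_tp_ltr ll kk kT); lia.
  + move=> k' k l' ki _ kk; rewrite !mem_index_iota in ki * => li /tpT lT.
    have [|l ll] := tp_desc _ lT; first by lia.
    exists l => //; rewrite mem_index_iota (anc_lt ll kk) ?andbT; last by lia.
    rewrite leqNgt; apply/negP => il.
    have := anc_tp_ltl ll ji lT il; lia.
Qed.

End Monotonicity.

(** * Evaluation at a timestamp *)

Theorem theorem3p6 (P R : finType) (V : eqType) (D : Type) (iota : P -> nat)
    (hD : inhabited D)
    (phi : mtl R V iota) (mu nu : valuation V D) (u v : word R D iota)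
    (tau : rat) (htau : 0 <= tau)
    (hu : observation u) (hv : observation v)
    (huv : refines u v) (hmunu : pext mu nu) :
  kle (sem_at phi u tau mu) (sem_at phi v tau nu).
Proof.
have wu := wf_observation hu; have [wv uv] := wf_refines wu huv.
rewrite /sem_at; case: pickP => [j /asboolP jt|_]; last by apply/kleP.
have tj : is_tp u j by exists tau.
have [i ji] := tp_desc wu uv (ltn_ord j) tj.
have it := anc_tp wv ji tj; rewrite jt in it; have [_ iv _ _] := ji.
case: pickP => [i' /asboolP it'|/(_ (Ordinal iv))/asboolP//].
(* [pick] may return any position with this interval; disjointness in [v] leaves only [i]. *)
suff -> : i' = i :> nat by apply: sem_anc.
by apply: (@ival_inj _ _ _ _ v i' i tau) => //; rewrite ?it ?it'.
Qed.
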